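(* Let $\widetilde{r}_{3,4}(n)=\operatorname{CT}_{X_1,\ldots,X_4}\big(\sigma_3(Y_1,Y_2,Y_3,Y_4)\big)^{2n}$ with $Y_j=X_j+X_j^{-1}$, and let $\widetilde{R}_{3,4}(z)=\sum_{n\ge0}\widetilde{r}_{3,4}(n)z^n$. Then $\widetilde{R}_{3,4}(z)$ satisfies a linear differential equation of order $8$ and degree $16$: there exist polynomials $u_0(z),\ldots,u_8(z)\in\mathbb{Q}[z]$ of degree at most $16$, with $u_8\neq 0$ and at least one $u_k$ of degree exactly $16$, such that $\big(u_0(z)+u_1(z)\vartheta+\cdots+u_8(z)\vartheta^8\big)\widetilde{R}_{3,4}(z)=0$, where $\vartheta=z\frac{d}{dz}$. Accordingly, $\widetilde{r}_{3,4}(n)$ satisfies a linear recurrence of order $16$ with polynomial coefficients.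
   Context: $\sigma_3(y_1,\ldots,y_4)=\sum_{1\le a<b<c\le 4}y_ay_by_c$. $\operatorname{CT}$ denotes the constant term (coefficient of $X_1^0\cdots X_4^0$) of a Laurent polynomial. $\widetilde r_{3,4}(n)$ equals the number of $2n$-step closed walks in $\mathbb{Z}^4$ with steps in $\{-1,0,1\}^4$ having exactly three nonzero coordinates. A sequence $s(n)$ satisfies a linear recurrence of order $L$ with polynomial coefficients if there are polynomials $h_0(n),\ldots,h_L(n)$, with $h_0$ and $h_L$ not identically zero, such that $\sum_{j=0}^L h_j(n)s(n+j)=0$ for all $n\ge0$. *)

(* Defs.v *)
From HB Require Import structures.
From mathcomp Require Import all_boot all_order all_algebra.
Set Implicit Arguments. Unset Strict Implicit. Unset Printing Implicit Defensive.
Import Order.TTheory GRing.Theory Num.Theory.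
Local Open Scope ring_scope.

Definition coord_val (c : 'I_3) : int := (nat_of_ord c)%:Z - 1.

Definition step := {ffun 'I_4 -> 'I_3}.

(* monomial X^v appears in sigma_3(Y_1..Y_4) iff exactly three coordinates nonzero *)
Definition valid_step (v : step) : bool :=
  #|[set i : 'I_4 | coord_val (v i) != 0]| == 3%N.

(* CT (sigma_3(Y))^(2n): expanding sigma_3(Y) = sum_{valid v} X^v (each with
   coefficient 1), the constant term of the 2n-th power counts the 2n-tuples
   of valid steps whose sum is 0. *)
Definition r34 (n : nat) : nat :=
  #|[set w : {ffun 'I_(2 * n) -> step} |
      [forall i, valid_step (w i)] &&
      [forall j : 'I_4, \sum_(i < 2 * n) coord_val (w i j) == 0]]|.

Definition fps := nat -> rat.

Definition theta (f : fps) : fps := fun n => n%:R * f n.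

Definition pmul (p : {poly rat}) (f : fps) : fps :=
  fun n => \sum_(i < n.+1) p`_i * f (n - i)%N.

Definition apply_op (L : nat) (u : 'I_L.+1 -> {poly rat}) (f : fps) : fps :=
  fun n => \sum_(k < L.+1) pmul (u k) (iter k theta f) n.

Definition R34 : fps := fun n => (r34 n)%:R.

Definition has_poly_recurrence (s : nat -> rat) (L : nat) : Prop :=
  exists h : 'I_L.+1 -> {poly rat},
    h ord0 != 0 /\ h ord_max != 0 /\
    forall n : nat, \sum_(j < L.+1) (h j).[n%:R] * s (n + j)%N = 0.

(* Main.v *)
(** With Y_j = X_j + 1/X_j, integrating by parts in X_1 gives linear relations
    between the constant terms of sigma_3(Y)^k Y_1^a Y_2^b Y_3^c Y_4^d.  Modulo
    these relations the vector v(n) of the constant terms of sigma_3(Y)^(2n)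
    times 1, Y_1 Y_2, Y_1 Y_2 Y_3 Y_4 and Y_1^2 Y_2^2 spans a module closed under
    n -> n-1: D(n) v(n-1) = N(n) v(n) with polynomial D and N.  Write the operator
    as sum_i z^i P_i(theta).  Its partial sums telescope: there are row vectors
    Q_j of polynomials with
      sum_(i >= j) P_i(n-i) r(n-i) = Q_j(n-j) . v(n-j),
    obtained by Q_j(x) = P_j(x) e_1 + Q_(j+1)(x-1) D(x)^-1 N(x), and Q_0 = 0. *)

From Stdlib Require Import BinInt.
Require Import Defs.
From HB Require Import structures.
From mathcomp Require Import all_boot all_order all_algebra.
From mathcomp Require Import ssrZ ring lra.
Import Order.TTheory GRing.Theory Num.Theory.
Local Open Scope ring_scope.

Set Implicit Arguments.
Unset Strict Implicit.
Unset Printing Implicit Defensive.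

(* [%Z] already delimits mathcomp's [int_scope]. *)
Local Delimit Scope Z_scope with coqZ.

(** * Constant terms and integration by parts *)

(* The coefficient of X^s in (X + 1/X)^a. *)
Fixpoint laurent_coef (a : nat) (s : int) : rat :=
  if a is b.+1 then laurent_coef b (s - 1) + laurent_coef b (s + 1)
  else (s == 0)%:R.

(* The constant term of sigma_3(Y)^k Y_1^a Y_2^b Y_3^c Y_4^d; a step of the
   recursion expands one factor sigma_3(Y). *)
Fixpoint CT (k a b c d : nat) : rat :=
  if k is l.+1 then
    CT l a b.+1 c.+1 d.+1 + CT l a.+1 b c.+1 d.+1 +
    CT l a.+1 b.+1 c d.+1 + CT l a.+1 b.+1 c.+1 d
  else laurent_coef a 0 * laurent_coef b 0 * laurent_coef c 0 * laurent_coef d 0.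

(* X d/dX sends Y^(a+1) to (a+1) Y^a (X - 1/X). *)
Lemma laurent_coef_euler a s :
  s%:~R * laurent_coef a.+1 s =
  a.+1%:R * (laurent_coef a (s - 1) - laurent_coef a (s + 1)).
Proof.
elim: a s => [|a IH] s /=.
  rewrite subr_eq0 addr_eq0 mul1r.
  have [->|_] := eqVneq s 1; first by [].
  by have [->|_] := eqVneq s (- 1); rewrite ?mulr0.
have := IH (s - 1); have := IH (s + 1) => /=.
rewrite !addrK !rmorphD /= !rmorphN /= => H1 H2.
have -> : a.+2%:R = a.+1%:R + 1 :> rat by rewrite -natr1.
move: H1 H2.
set A := laurent_coef a (s - 1 - 1); set B := laurent_coef a s.
set C := laurent_coef a (s + 1 + 1); set y := a.+1%:R => H1 H2.
(* Writing s as (s - 1) + 1 on the first half and (s + 1) - 1 on the second makes the induction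
   hypotheses at s - 1 and s + 1 applicable. *)
rewrite -[LHS](_ : (s%:~R - 1) * (A + B) + (A + B) +
                   ((s%:~R + 1) * (B + C) - (B + C)) = _); last by ring.
by rewrite H1 H2; ring.
Qed.

(** The Euler relation at s = 1 and s = -1 eliminates the coefficients at 2 and -2, leaving a
    recurrence for the central one. *)
Lemma laurent_coef0_rec a :
  a.+2%:R * laurent_coef a.+2 0 = 4 * a.+1%:R * laurent_coef a 0.
Proof.
have := laurent_coef_euler a 1; have := laurent_coef_euler a (-1).
have -> : laurent_coef a.+2 0 = laurent_coef a.+1 (-1) + laurent_coef a.+1 1 by [].
have -> : -1 + 1 = 0 :> int by [].
rewrite subrr -[a.+2%:R]natr1 mul1r mulN1r.
have -> : laurent_coef a.+1 (-1) = laurent_coef a (-1 - 1) + laurent_coef a 0 by [].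
have -> : laurent_coef a.+1 1 = laurent_coef a 0 + laurent_coef a (1 + 1) by [].
set y := a.+1%:R; nra.
Qed.

(** A swap of variables permutes the four monomials of sigma_3. The three adjacent swaps are the
    comparators from which [sort_exps] is built. *)
Lemma CT_swap12 k a b c d : CT k a b c d = CT k b a c d.
Proof.
elim: k a b c d => [|k IH] a b c d /=; first by ring.
by rewrite (IH b a.+1) (IH b.+1 a) (IH b.+1 a.+1 c) (IH b.+1 a.+1 c.+1); ring.
Qed.

Lemma CT_swap23 k a b c d : CT k a b c d = CT k a c b d.
Proof.
elim: k a b c d => [|k IH] a b c d /=; first by ring.
by rewrite (IH a c.+1) (IH a.+1 c b.+1) (IH a.+1 c.+1 b) (IH a.+1 c.+1 b.+1); ring.
Qed.

Lemma CT_swap34 k a b c d : CT k a b c d = CT k a b d c.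
Proof.
elim: k a b c d => [|k IH] a b c d /=; first by ring.
by rewrite (IH a b.+1 d.+1) (IH a.+1 b d.+1) (IH a.+1 b.+1 d) (IH a.+1 b.+1 d.+1);
  ring.
Qed.

(* The factor d sigma_3 / d Y_1 = Y_3 Y_4 + Y_2 Y_4 + Y_2 Y_3 is inserted. *)
Definition CT_dsigma k a b c d : rat :=
  CT k a b c.+1 d.+1 + CT k a b.+1 c d.+1 + CT k a b.+1 c.+1 d.

(* The constant term of X_1 d/dX_1 applied to
   (X_1 - 1/X_1) Y_1^m Y_2^b Y_3^c Y_4^d sigma_3(Y)^k is 0; note that
   (X_1 - 1/X_1)^2 = Y_1^2 - 4. *)
Lemma CT_ibp k m b c d :
  m.+1%:R * CT k m.+1 b c d - 4 * m%:R * CT k m.-1 b c d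
  + k%:R * (CT_dsigma k.-1 m.+2 b c d - 4 * CT_dsigma k.-1 m b c d) = 0.
Proof.
elim: k m b c d => [|k IH] m b c d.
  rewrite mul0r addr0 /CT.
  case: m => [|m]; first by rewrite /=; ring.
  rewrite !mulrA laurent_coef0_rec /=; ring.
(* One instance for each monomial of sigma_3. In the three that contain Y_1, the coefficients for m
   + 1 exceed those for m by 1 and 4; the excess is the extra copy of the [CT_dsigma] terms that
   turns k into k + 1. *)
have := IH m b.+1 c.+1 d.+1; have := IH m.+1 b c.+1 d.+1.
have := IH m.+1 b.+1 c d.+1; have := IH m.+1 b.+1 c.+1 d.
rewrite /CT_dsigma -[m.+2%:R]natr1 -[m.+1%:R]natr1 -[k.+1%:R]natr1 /=.
move=> H1 H2 H3 H4.
rewrite -[RHS](_ : 0 + 0 + 0 + 0 = _); last by rewrite !addr0.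
rewrite -{1}H1 -{1}H2 -{1}H3 -{1}H4 {H1 H2 H3 H4 IH}.
by case: k m => [|k] [|m] /=;
  rewrite ?mulr0n -?[k.+1%:R]natr1 -?[m.+1%:R]natr1; ring.
Qed.

(** * Counting walks *)

(** A step is valid iff its set of zero coordinates is a singleton {i}. As a sum of products over
    coordinates, the indicator lets a sum over all steps factor coordinate by coordinate. *)
Lemma valid_stepE (v : step) : (valid_step v)%:R =
  \sum_(i < 4) \prod_(j < 4) ((coord_val (v j) == 0) == (j == i))%:R :> rat.
Proof.
set Z := [set j | coord_val (v j) == 0].
have prodE i : \prod_(j < 4) ((coord_val (v j) == 0) == (j == i))%:R =
               (Z == [set i])%:R :> rat.
  have [/setP ZE|/eqP nZ] := eqVneq Z [set i].
    apply: big1 => j _; have := ZE j; rewrite !inE => ->. by rewrite eqxx.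
  have [j jZ] : exists j, (coord_val (v j) == 0) != (j == i).
    apply/existsP; apply: contra_notT nZ; rewrite negb_exists => /forallP h.
    by apply/setP => j; rewrite !inE; have := h j; rewrite negbK => /eqP.
  by rewrite (bigD1 j) //= (negbTE jZ) mul0r.
under eq_bigr => i _ do rewrite prodE.
have -> : valid_step v = (#|Z| == 1%N).
  have -> : valid_step v = (#|~: Z| == 3).
    have -> : ~: Z = [set j | coord_val (v j) != 0] by apply/setP => j; rewrite !inE.
    by [].
  by rewrite -(eqn_add2l #|Z|) cardsC card_ord -[4%N]/(1 + 3)%N eqn_add2r eq_sym.
have [/cards1P[i0 ->]|nZ] := boolP (#|Z| == 1%N).
  rewrite (bigD1 i0) //= eqxx big1 ?addr0 // => i ii0.
  by rewrite (inj_eq set1_inj) eq_sym (negbTE ii0).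
rewrite big1 // => i _; case: eqP => // ZE.
by rewrite ZE cards1 in nZ.
Qed.

Lemma sum_valid_step (f : 'I_4 -> int -> rat) :
  \sum_(v : step | valid_step v) \prod_(j < 4) f j (coord_val (v j)) =
  \sum_(i < 4) \prod_(j < 4) (if j == i then f j 0 else f j (-1) + f j 1).
Proof.
rewrite big_mkcond /=.
under eq_bigr => v _.
  have -> : (if valid_step v then \prod_(j < 4) f j (coord_val (v j)) else 0) =
            (valid_step v)%:R * \prod_(j < 4) f j (coord_val (v j)).
    by case: ifP => _; rewrite ?mul1r ?mul0r.
  rewrite valid_stepE mulr_suml.
  under eq_bigr => i _ do rewrite -big_split /=.
  over.
rewrite exchange_big /=; apply: eq_bigr => i _.
rewrite -(bigA_distr_bigA (fun j (t : 'I_3) =>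
  ((coord_val t == 0) == (j == i))%:R * f j (coord_val t))) /=.
apply: eq_bigr => j _; rewrite !big_ord_recl big_ord0 /coord_val /=.
by case: (j == i); rewrite /= ?mul0r ?mul1r ?addr0 ?add0r.
Qed.

Lemma sum_ffun_recl (T : finType) k (F : {ffun 'I_k.+1 -> T} -> rat)
    (c := fun v (w : {ffun 'I_k -> T}) =>
      [ffun i => if unlift ord0 i is Some j then w j else v]) :
  \sum_w F w = \sum_w \sum_v F (c v w).
Proof.
rewrite exchange_big pair_big /=.
rewrite (reindex (fun p : T * {ffun 'I_k -> T} => c p.1 p.2)) //=.
exists (fun w : {ffun 'I_k.+1 -> T} => (w ord0, [ffun i => w (lift ord0 i)])).
  move=> [v w] _; rewrite !ffunE unlift_none /=; congr pair.
  by apply/ffunP => i; rewrite !ffunE liftK.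
move=> w _; apply/ffunP => i; rewrite !ffunE /=.
by case: unliftP => [j ->|->] //; rewrite ffunE.
Qed.

(** Closedness is relaxed to a weight on the endpoint, which for zero exponents is the indicator of
    the origin. The induction absorbs the first step into the exponents: each coordinate it moves
    gains one factor Y_j. *)
Lemma walks_CT k a b c d (l := fun j : 'I_4 => nth 0%N [:: a; b; c; d] j) :
  \sum_(w : {ffun 'I_k -> step} | [forall i, valid_step (w i)])
    \prod_(j < 4) laurent_coef (l j) (\sum_(i < k) coord_val (w i j)) =
  CT k a b c d.
Proof.
elim: k a b c d @l => [|k IH] a b c d l.
  have w0 (w : {ffun 'I_0 -> step}) : w = [ffun => [ffun => ord0]].
    by apply/ffunP => -[].
  rewrite (big_pred1 [ffun => [ffun => ord0]]) => [|w].
    rewrite !big_ord_recl !big_ord0 /=; ring.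
  by rewrite /= [w]w0 eqxx; apply/forallP => -[].
rewrite big_mkcond sum_ffun_recl.
pose l1 i := fun j : 'I_4 => if j == i then l j else (l j).+1.
transitivity (\sum_(i < 4)
    \sum_(w : {ffun 'I_k -> step} | [forall i, valid_step (w i)])
    \prod_(j < 4) laurent_coef (l1 i j) (\sum_(i < k) coord_val (w i j))).
  rewrite [RHS]exchange_big [RHS]big_mkcond /=; apply: eq_bigr => w _.
  set s := fun j => \sum_(i < k) coord_val (w i j).
  transitivity (\sum_(v : step | valid_step v)
      if [forall i, valid_step (w i)]
      then \prod_(j < 4) laurent_coef (l j) (coord_val (v j) + s j) else 0).
    rewrite [RHS]big_mkcond; apply: eq_bigr => v _.
    have -> : [forall i, valid_step ([ffun i => if unlift ord0 i is Some j
                 then w j else v] i)] = valid_step v && [forall i, valid_step (w i)].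
      apply/forallP/andP => [h|[v0 /forallP h] i].
        split; first by have := h ord0; rewrite ffunE unlift_none.
        by apply/forallP => i; have := h (lift ord0 i); rewrite ffunE liftK.
      by rewrite ffunE; case: unliftP.
    case: (valid_step v) => //=; case: ifP => // _; apply: eq_bigr => j _.
    rewrite big_ord_recl ffunE unlift_none; congr (laurent_coef _ (_ + _)).
    by apply: eq_bigr => i _; rewrite ffunE liftK.
  case: ifP => [_|]; last by rewrite big1.
  rewrite (sum_valid_step (fun j x => laurent_coef (l j) (x + s j))).
  apply: eq_bigr => i _; apply: eq_bigr => j _; rewrite /l1.
  by case: ifP => _; rewrite ?add0r //= [-1 + _]addrC [1 + _]addrC.
rewrite !big_ord_recl big_ord0 addr0 /= -!IH !addrA.
by congr (_ + _ + _ + _); apply: eq_bigr => w _; rewrite !big_ord_recl !big_ord0.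
Qed.

Lemma r34_CT n : (r34 n)%:R = CT (2 * n) 0 0 0 0.
Proof.
rewrite -walks_CT /r34 -sum1_card natr_sum big_mkcond [RHS]big_mkcond /=.
apply: eq_bigr => w _; rewrite inE; case: [forall i, _] => //=.
case: forallP => [h|h].
  rewrite big1 // => j _; rewrite (eqP (h j)).
  by case: j => -[|[|[|[|]]]].
have [j jn] : exists j : 'I_4, \sum_(i < 2 * n) coord_val (w i j) != 0.
  apply/existsP; apply: contra_notT h; rewrite negb_exists => /forallP h j.
  by have := h j; rewrite negbK.
rewrite (bigD1 j) //=.
have -> : nth 0%N [:: 0; 0; 0; 0]%N j = 0%N by case: j {jn} => -[|[|[|[|]]]].
by rewrite /= (negbTE jn) mul0r.
Qed.

(** * Linear relations with polynomial coefficients *)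

Definition ratZ (z : Z) : rat := (int_of_Z z)%:~R.

(** Polynomials are lists of binary integers, constant coefficient first, so that the certificates
    can be checked by [vm_compute]. *)
Fixpoint peval (x : rat) (p : seq Z) : rat :=
  if p is c :: q then ratZ c + x * peval x q else 0.

Fixpoint padd (p q : seq Z) : seq Z :=
  match p, q with
  | [::], _ => q
  | _, [::] => p
  | a :: p', b :: q' => Z.add a b :: padd p' q'
  end.

Definition pscale (c : Z) (p : seq Z) : seq Z := [seq Z.mul c a | a <- p].

Fixpoint pmulz (p q : seq Z) : seq Z :=
  if p is a :: p' then padd (pscale a q) (Z0 :: pmulz p' q) else [::].

Definition pzero (p : seq Z) : bool := all (fun c => c == Z0) p.

Lemma ratZD a b : ratZ (Z.add a b) = ratZ a + ratZ b.
Proof. by rewrite -rmorphD -[int_of_Z a + _]rmorphD. Qed.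

Lemma ratZM a b : ratZ (Z.mul a b) = ratZ a * ratZ b.
Proof. by rewrite -rmorphM -[int_of_Z a * _]rmorphM. Qed.

Lemma peval_add x p q : peval x (padd p q) = peval x p + peval x q.
Proof.
elim: p q => [|a p IH] [|b q] /=; rewrite ?add0r ?addr0 //.
by rewrite ratZD IH; ring.
Qed.

Lemma peval_scale x c p : peval x (pscale c p) = ratZ c * peval x p.
Proof. by elim: p => [|a p IH] /=; rewrite ?mulr0 // ratZM IH; ring. Qed.

Lemma peval_mul x p q : peval x (pmulz p q) = peval x p * peval x q.
Proof.
elim: p => [|a p IH] /=; first by rewrite mul0r.
by rewrite peval_add peval_scale /= IH [ratZ Z0]mulr0z; ring.
Qed.

Lemma peval_zero x p : pzero p -> peval x p = 0.
Proof. by elim: p => //= c p IH /andP[/eqP-> /IH->]; rewrite mulr0 addr0. Qed.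

(** The polynomial p(X - 1), by Horner's scheme. *)
Definition pshift (p : seq Z) : seq Z :=
  foldr (fun c q => padd [:: c] (pmulz [:: (-1)%coqZ; 1%coqZ] q)) [::] p.

Lemma peval_shift x p : peval (x + 1) (pshift p) = peval x p.
Proof.
elim: p => // c p IH.
have -> : pshift (c :: p) =
          padd [:: c] (pmulz [:: (-1)%coqZ; 1%coqZ] (pshift p)) by [].
have eN1 : ratZ (-1)%coqZ = -1 by [].
have e1 : ratZ 1%coqZ = 1 by [].
rewrite peval_add peval_mul IH /= eN1 e1; ring.
Qed.

Definition exps := (nat * nat * nat * nat)%type.

Definition CTe (k : nat) (e : exps) : rat := let: (a, b, c, d) := e in CT k a b c d.

(** A coefficient in x, an offset to the power of sigma_3, and the exponents of the Y_j. The base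
    power stays symbolic, so one computation serves all n. *)
Definition term := (seq Z * nat * exps)%type.

Definition lincomb (x : rat) (base : nat) (L : seq term) : rat :=
  \sum_(t <- L) peval x t.1.1 * CTe (base + t.1.2) t.2.

Definition scale_terms (p : seq Z) (L : seq term) : seq term :=
  [seq (pmulz p t.1.1, t.1.2, t.2) | t <- L].

Definition expand_term (t : term) : seq term :=
  if t is (p, l.+1, (a, b, c, d)) then
    [:: (p, l, (a, b.+1, c.+1, d.+1)); (p, l, (a.+1, b, c.+1, d.+1));
        (p, l, (a.+1, b.+1, c, d.+1)); (p, l, (a.+1, b.+1, c.+1, d))]
  else [:: t].

Definition expand (L : seq term) : seq term := flatten (map expand_term L).

Definition order12 (e : exps) : exps :=
  let: (a, b, c, d) := e in if (a < b)%N then (b, a, c, d) else e.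
Definition order23 (e : exps) : exps :=
  let: (a, b, c, d) := e in if (b < c)%N then (a, c, b, d) else e.
Definition order34 (e : exps) : exps :=
  let: (a, b, c, d) := e in if (c < d)%N then (a, b, d, c) else e.
Definition sort_exps (e : exps) : exps :=
  order12 (order23 (order12 (order34 (order23 (order12 e))))).

Fixpoint collect_term (t : term) (L : seq term) : seq term :=
  if L is u :: M then
    if (t.1.2 == u.1.2) && (t.2 == u.2) then (padd t.1.1 u.1.1, u.1.2, u.2) :: M
    else u :: collect_term t M
  else [:: t].

Definition collect (L : seq term) : seq term :=
  foldr (fun t M => collect_term (t.1, sort_exps t.2) M) [::] L.

(* All terms are expanded down to the lowest power of sigma_3(Y), where like
   terms are collected up to permutation of the variables. *)
Definition vanishes (L : seq term) : bool :=
  all (fun t : term => pzero t.1.1)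
    (collect (expand (collect (expand (collect (expand L)))))).

Lemma lincomb_cat x base L M :
  lincomb x base (L ++ M) = lincomb x base L + lincomb x base M.
Proof. exact: big_cat. Qed.

Lemma lincomb_cons x base t L :
  lincomb x base (t :: L) =
  peval x t.1.1 * CTe (base + t.1.2) t.2 + lincomb x base L.
Proof. exact: big_cons. Qed.

Lemma lincomb_scale x base p L :
  lincomb x base (scale_terms p L) = peval x p * lincomb x base L.
Proof.
rewrite /lincomb big_map big_distrr /=.
by apply: eq_bigr => t _; rewrite peval_mul mulrA.
Qed.

Lemma lincomb_expand x base L : lincomb x base (expand L) = lincomb x base L.
Proof.
elim: L => // t L IH.
rewrite [expand _]/(_ ++ expand L) lincomb_cat IH lincomb_cons; congr (_ + _).
case: t => [[p [|l]] [[[a b] c] d]]; rewrite /lincomb !big_cons big_nil //=.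
  by rewrite addr0.
by rewrite addnS /=; ring.
Qed.

Lemma CTe_sort k e : CTe k (sort_exps e) = CTe k e.
Proof.
have s12 f : CTe k (order12 f) = CTe k f.
  by case: f => [[[a b] c] d] /=; case: ifP => //= _; rewrite CT_swap12.
have s23 f : CTe k (order23 f) = CTe k f.
  by case: f => [[[a b] c] d] /=; case: ifP => //= _; rewrite CT_swap23.
have s34 f : CTe k (order34 f) = CTe k f.
  by case: f => [[[a b] c] d] /=; case: ifP => //= _; rewrite CT_swap34.
by rewrite /sort_exps !(s12, s23, s34).
Qed.

Lemma lincomb_collect x base L : lincomb x base (collect L) = lincomb x base L.
Proof.
have ins t M : lincomb x base (collect_term t M) = lincomb x base (t :: M).
  elim: M => //= u M IH; case: ifP => [/andP[/eqP e1 /eqP e2]|_].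
    by rewrite !lincomb_cons /= peval_add e1 e2; ring.
  by rewrite lincomb_cons IH !lincomb_cons; ring.
elim: L => // t L IH.
by rewrite /= ins !lincomb_cons -/(collect L) IH /= CTe_sort.
Qed.

Lemma vanishesP x base L : vanishes L -> lincomb x base L = 0.
Proof.
move=> /allP vL; rewrite -lincomb_expand -lincomb_collect -lincomb_expand.
rewrite -lincomb_collect -lincomb_expand -lincomb_collect /lincomb big_seq.
by apply: big1 => t /vL/peval_zero->; rewrite mul0r.
Qed.

(** * The first-order system and the telescoping sum *)

(* Row i lists the coefficients of P_i.  They were found by linear algebra from
   the first values of r; the factor 9 common to all entries makes the
   polynomials Q_j integral. *)
Definition annihilator : seq (seq Z) := [::
  [:: 0; 0; 0; 0; -378; 3213; -10017; 13608; -6804];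
  [:: 12096; 169344; 919296; 1911168; -931549248; 7102359936; -17552336256;
      17865453312; -5922963648];
  [:: -14755184640; -141112516608; -413010468864; 369443192832; -42454375317504;
      95030679748608; -55950138556416; 57150317076480; 6749282672640];
  [:: -1028404046462976; -9952675312435200; -39354013637148672;
      -78817659630649344; -2069561440246431744; 6119401414204588032;
      -8899569838621458432; 5014830946719891456; -1006654476508987392];
  [:: 10901423609125797888; 83285795343949627392; 228359952141108903936;
      181564506193621155840; -301073886525152821248; 2585051237378609381376;
      -11099436181143221698560; 5284612222534023118848;
      1498482780865975812096];
  [:: 52425472225335803117568; 329683373234222675263488;
      322745429465826651537408; -2571281326687472289054720;
      31676663384020061603758080; -129845278556617824119291904;
      87443432517599202908307456; -57358399230406492415852544;
      7030406680293433682165760];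
  [:: 757370961533587425765359616; 6536828417901825938618843136;
      23481379935357437978905411584; 46735479377633526780197339136;
      78411196519900761127208878080; -27830562268072322772064272384;
      69768666847529411578020495360; 11633503359636543663004188672;
      -14734328041520111935215894528];
  [:: -440443253277640719692929695744; -3228740264368970080207157329920;
      -10222251524078297984464934928384; -16687506572751037630870053715968;
      -28651164968650918821095528202240; -8147804480310248334429316448256;
      29630729255428040771470538833920; 51917216853305777758590147231744;
      6590083860213575588729881362432];
  [:: -27413083632109625096557773717504; -2582262367464266613777145371033600;
      -20298489391268025361478264687689728;
      -68505585463901037298873561440583680;
      -113958216913788369048749141586345984;
      -131595969576735122731263755588468736;
      -57891586705936904876584308383416320;
      -12441843123818526426290416829595648;
      1347280978170638861393561760301056];
  [:: 702199639878278789115595936575258624;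
      4527838223892588679906018837521235968;
      10878211799547157569990703414039805952;
      10188833544840531851116830833887936512;
      -823118172377742683848815484801646592;
      -13681332187952116157188773812537131008;
      -12982673386809484398850144465116463104;
      -3230936047413965568947417640635203584;
      -870472876549827778570283597030227968];
  [:: 132104417711390260754013088418963128320;
      972491617156647555282124405267205455872;
      3013987266278495500394357362336456507392;
      5160248602610467048844701971045628772352;
      5277363447537609475174186497709499744256;
      3481126949728569458578745851676568059904;
      731838544626326538521597192920809603072;
      478078551736127196292177160447415287808;
      161876450798134621350045007521263910912];
  [:: -8922518923773452505786515838261081931776;
      -58159792590431381706466240925359958654976;
      -160897678730965080478043740691496406351872;
      -280772766170407327470479831699711154192384;
      -408624410394482655774533520418091223220224;
      -497015795231439036638008258629906984861696;
      -421691463765904871048791871056694199975936;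
      -180303200887254051693065285582296172199936;
      -12286095954830004657257782357625042632704];
  [:: 2231626552492483511562024093743418578042880;
      17268248777230878969908642830944896079101952;
      55157887502655874072381535138401463190945792;
      93091360324829681923133536906709012462960640;
      85933969703764546777429806959833001062563840;
      35650789782451547903641443604776241317543936;
      -4362500912839593686642067420409610895360000;
      -9631661281158763721763579626503677451173888;
      -2402841428407846251312904753993922490925056];
  [:: 168731968765279266005405904446490183223738368;
      1313713934611393669695550266881915610124517376;
      4286598774469400314262391740559212557816037376;
      7657843240441612780199980060856769587428982784;
      8191541877866583417890445546672254524418162688;
      5363182370592271425510667549691889069267615744;
      2075917401540854629712675954783954130916343808;
      430717779757514690712946919825068826063536128;
      31063841286870085335786096326092726858678272];
  [:: 184493004540366172640662724640448476579102720;
      1621736245771140755695684306900959935896485888;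
      6014924599715972541827705538880807090186616832;
      12294994424279709944255388173755582459347468288;
      15257236139762853703160685197231680889064259584;
      12101525855060784984060407516226442032511451136;
      6485139764999915672319919975386567319939448832;
      2437957758786860598970847057622561244097544192;
      519094784687475321718989949576445652073709568];
  [:: -6684168392075558461084302391630015226078822400;
      -57851918072592890302055008109813560990173757440;
      -213060572859833891920643444188092608149563899904;
      -436163647085227544522224534509689068858562838528;
      -542851365968505790684452220351651745114609418240;
      -420636435095785143589448309135637041084469608448;
      -198247684026583491844599498778966524162553675776;
      -52082375182511746137022816388827707440759832576;
      -5902088147337357075462887191432915841294794752];
  [:: 1359236909540285301171368306975128040515829760;
      12301094031339581975600883178124908766668259328;
      47728093815274295811409074356868315444890566656;
      103800391991893120832786826376000611360725532672;
      138525119372565353929656477262806868551347994624;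
      116260063662679069426857702523272618398787305472;
      59972552975383032566127817188869260543203999744;
      17398232442115651854993514329281638918602620928;
      2174779055264456481874189291160204864825327616]]%coqZ.

(* The numerators N(x), with one denominator [rowD a] for each row a. *)
Definition rowN : seq (seq (seq Z)) := [::
  [:: [:: -2592; -8208; 81360; 279888; -1989552; -6919488; -5384448; 331776];
      [:: -216; -4032; -336; 156528; 93480; -2948784; -5996160; -2992896];
      [:: 324; 1107; -9807; -36431; 231643; 934860; 1039248; 366336];
      [:: 648; 1728; -20448; -58128; 498264; 1450704; 1282176; 366336]];
  [:: [:: 864; 11088; 52800; 97296; 61056];
      [:: 72; 2040; 17496; 60792; 80112; 33984];
      [:: -108; -1413; -6998; -14513; -12816; -4032];
      [:: -216; -2664; -12120; -21144; -15504; -4032]];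
  [:: [:: -864; -7632; -17664; -13200; -1728];
      [:: -72; -1752; -9144; -13848; -6096];
      [:: 108; 981; 2546; 2513; 852];
      [:: 216; 1800; 3768; 3000; 816]];
  [:: [:: -864; -8784; -41280; -78096; -47616; 6912];
      [:: -72; -1464; -11928; -44472; -61488; -26688];
      [:: 108; 1141; 5478; 11425; 10088; 3120];
      [:: 216; 2088; 9432; 16728; 12432; 3264]]]%coqZ.

Definition rowK : seq Z := [:: 294912; 73728; 6144; 6144]%coqZ.

(* The relations [CT_ibp k m b c d] that are used, listed as
   (k - (2 * x - 2), m, b, c, d). *)
Definition ibps : seq (nat * nat * nat * nat * nat) := [::
  (0,0,1,1,1); (0,0,2,2,1); (0,0,3,3,3); (0,1,0,0,0); (0,1,2,0,0); (0,1,2,2,0);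
  (0,2,1,1,1); (0,2,3,1,1); (0,2,3,2,2); (1,0,0,0,0); (1,0,1,1,0);
  (1,0,2,1,1); (1,0,2,2,2); (1,1,1,0,0); (1,1,2,1,0); (1,1,2,2,1);
  (1,2,1,1,0); (1,2,2,1,1); (2,1,0,0,0); (2,1,2,0,0)]%N.

(* The multipliers of these relations which produce the four rows of
   D(x) v(x-1) = N(x) v(x); found by solving a linear system over Q(x). *)
Definition rowM : seq (seq (seq Z)) := [::
  [:: [:: 0; 0; -12288; 12288; 393216; 147456; -1769472];
      [:: 0; -216; 1584; 9240; -9264; 93312; -241920];
      [:: 0; 36; -72; -1220; 2440; 30528; -61056];
      [:: 0; 0; -147456; -147456; 3244032; 2359296; -14155776];
      [:: 0; 0; 0; 221184; 1105920; -442368; -5308416];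
      [:: 0; -1080; 7920; -9096; -322800; 577152; 117504];
      [:: 0; 432; 6048; -58416; -214944; 2135808; -3055104];
      [:: 0; -1296; 2592; 43920; -87840; -1099008; 2198016];
      [:: 0; -108; 216; 3660; -7320; -91584; 183168];
      [:: 0; 0; 12288; 0; -380928; -516096; 884736];
      [:: 0; 216; -2448; -4632; -110448; -1199232; -1264896];
      [:: 216; 1548; -4704; -79596; 82824; 1100736; 1344384];
      [:: -324; -792; 10608; 26152; -257756; -687744; -335808];
      [:: 0; -432; 3168; 36912; -424032; -421632; 1838592];
      [:: 432; 1152; -16752; -85248; 479424; 276480; -1769472];
      [:: -972; -1728; 32148; 56496; -784248; -1513728; -732672];
      [:: -648; -5940; 13896; 274644; -306048; -4124736; -5985792];
      [:: 0; -324; -216; 10980; 7320; -274752; -183168];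
      [:: -432; 684; 16752; -47628; -427968; 275904; 1506816];
      [:: -324; -540; 10764; 18300; -267432; -457920; -183168]];
  [:: [::];
      [:: 0; 72; 168; -912; 576];
      [:: 0; -12; -92; -104; 672];
      [::];
      [::];
      [:: 0; 360; 840; -4560; 2880];
      [:: 0; -144; -3408; -10464; 35712];
      [:: 0; 432; 3312; 3744; -24192];
      [:: 0; 36; 276; 312; -2016];
      [:: 0; 0; -6144; -43008; -73728];
      [:: 0; -72; 120; 2160; -1728];
      [:: -72; -1212; -7812; -19272; -15840];
      [:: 108; 1308; 5716; 8836; 3696];
      [:: 0; 144; 336; -11040; -26496];
      [:: -144; -1776; -6912; 1344; 18432];
      [:: 324; 3708; 14952; 19416; 8064];
      [:: 216; 4068; 27684; 72528; 67968];
      [:: 0; 108; 1116; 3720; 2016];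
      [:: 144; 1164; 1188; -10224; -17280];
      [:: 108; 1224; 4836; 5736; 2016]];
  [:: [::];
      [:: 0; -72; 120; 48];
      [:: 0; 12; 44; -136];
      [::];
      [::];
      [:: 0; -360; 600; 240];
      [:: 0; 144; 2832; -6240];
      [:: 0; -432; -1584; 4896];
      [:: 0; -36; -132; 408];
      [::];
      [:: 0; 72; -408; -144];
      [:: 72; 924; 2772; 2424];
      [:: -108; -876; -1684; -772];
      [:: 0; -144; 240; 96];
      [:: 144; 1200; -576; -4800];
      [:: -324; -2412; -3720; -1704];
      [:: -216; -3204; -10836; -11904];
      [:: 0; -108; -684; -408];
      [:: -144; -588; 972; 2880];
      [:: -108; -792; -1092; -408]];
  [:: [::];
      [:: 0; -72; -360; 912; 192];
      [:: 0; 12; 60; 104; -544];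
      [::];
      [::];
      [:: 0; -360; -1800; 4560; 960];
      [:: 0; 144; 720; 10464; -24960];
      [:: 0; -432; -2160; -3744; 19584];
      [:: 0; -36; -180; -312; 1632];
      [::];
      [:: 0; 72; -1464; -13680; -19008];
      [:: 72; 636; 4452; 12936; 12000];
      [:: -108; -1036; -4452; -6996; -2896];
      [:: 0; -144; -3792; -1248; 18816];
      [:: 144; 624; 3072; -2496; -14592];
      [:: -324; -2892; -11736; -15336; -6240];
      [:: -216; -2340; -17604; -52560; -54528];
      [:: 0; -108; -828; -2952; -1632];
      [:: -144; -1164; -2244; 6384; 13824];
      [:: -108; -936; -3780; -4584; -1632]]]%coqZ.

(* [:: c; k] encodes c + k * x; the denominator of row a is the product of the
   first [nth 0 rowlen a] factors, times [nth Z0 rowK a]. *)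
Definition factors : seq (seq Z) :=
  [:: [:: 0; 1]; [:: 0; 1]; [:: -1; 2]; [:: 1; 3]; [:: 1; 4]; [:: -1; 3];
      [:: -1; 4]]%coqZ.

Definition rowlen : seq nat := [:: 7; 5; 4; 5].

Definition master : seq exps :=
  [:: (0, 0, 0, 0); (1, 1, 0, 0); (1, 1, 1, 1); (2, 2, 0, 0)].

Definition pprod (s : seq (seq Z)) : seq Z := foldr pmulz [:: 1%coqZ] s.

Definition commonK : Z := 294912%coqZ.

Definition commonD : seq Z := pscale commonK (pprod factors).

Definition rowD (a : nat) : seq Z :=
  pscale (nth Z0 rowK a) (pprod (take (nth 0 rowlen a)%N factors)).

(** The cofactor of [rowD a] in [commonD]: row denominators use prefixes of [factors], and every
    [rowK] entry divides [commonK]. *)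
Definition rowC (a : nat) : seq Z :=
  pscale (Z.div commonK (nth Z0 rowK a)) (pprod (drop (nth 0 rowlen a)%N factors)).

Definition entryN (a b : nat) : seq Z := nth [::] (nth [::] rowN a) b.

Definition CTmaster (n b : nat) : rat := CTe (2 * n) (nth (0, 0, 0, 0)%N master b).

(* The relation [CT_ibp] at k = 2 * x - 2 + l, in the variable x. *)
Definition ibp_terms (i : nat * nat * nat * nat * nat) : seq term :=
  let: (l, m, b, c, d) := i in
  let K := [:: (Z.of_nat l - 2)%coqZ; 2%coqZ] in
  [:: ([:: Z.of_nat m.+1], l.+1, (m.+1, b, c, d));
      ([:: (-4 * Z.of_nat m)%coqZ], l.+1, (m.-1, b, c, d));
      (K, l, (m.+2, b, c.+1, d.+1));
      (K, l, (m.+2, b.+1, c, d.+1));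
      (K, l, (m.+2, b.+1, c.+1, d));
      (pscale (-4)%coqZ K, l, (m, b, c.+1, d.+1));
      (pscale (-4)%coqZ K, l, (m, b.+1, c, d.+1));
      (pscale (-4)%coqZ K, l, (m, b.+1, c.+1, d))].

(** Over the base power 2x - 3, the offsets 1 and 3 give the powers 2(x - 1) and 2x, hence v(x-1)
    and v(x). *)
Definition row_terms (a : nat) : seq term :=
  (rowD a, 1%N, nth (0, 0, 0, 0)%N master a) ::
  [seq (pscale (-1)%coqZ (entryN a b), 3, nth (0, 0, 0, 0)%N master b)
     | b <- iota 0 4].

Definition row_ibps (a : nat) : seq term :=
  flatten [seq scale_terms pi.1 (ibp_terms pi.2) | pi <- zip (nth [::] rowM a) ibps].

(** Offsets are at most 3, so three rounds of expansion reach the base power; there the coefficients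
    cancel as polynomials in x. *)
Lemma row_check : all (fun a => vanishes
  (row_terms a ++ scale_terms [:: (-1)%coqZ] (row_ibps a))) (iota 0 4).
Proof. by vm_compute. Qed.

Lemma ratZ_nat n : ratZ (Z.of_nat n) = n%:R.
Proof. by case: n => // n; rewrite /ratZ /= SuccNat2Pos.id_succ. Qed.

Lemma lincomb_ibp n i : lincomb n.+2%:R (2 * n).+1 (ibp_terms i) = 0.
Proof.
case: i => [[[[l m] b] c] d].
have eK : peval n.+2%:R [:: (Z.of_nat l - 2)%coqZ; 2%coqZ] = ((2 * n).+1 + l.+1)%:R.
  have -> : (Z.of_nat l - 2)%coqZ = Z.add (Z.of_nat l) (-2) by [].
  have e2 : ratZ 2%coqZ = 2 by [].
  have eN2 : ratZ (-2)%coqZ = - 2 by [].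
  by rewrite /= ratZD ratZ_nat e2 eN2; ring.
rewrite /ibp_terms; move: [:: _; 2%coqZ] eK => K eK.
rewrite -[RHS](CT_ibp ((2 * n).+1 + l.+1) m b c d) /CT_dsigma.
rewrite /lincomb !big_cons big_nil; cbn [fst snd CTe].
rewrite !peval_scale eK !addnS; cbn [peval predn].
have eN4 : ratZ (-4)%coqZ = - 4 by [].
by rewrite ratZM ![ratZ (Z.of_nat _)]ratZ_nat eN4; ring.
Qed.

Lemma lincomb_row_ibps n a : lincomb n.+2%:R (2 * n).+1 (row_ibps a) = 0.
Proof.
rewrite /row_ibps; elim: (zip _ _) => [|pi s IH]; first by rewrite /lincomb big_nil.
by rewrite [flatten _]/(_ ++ _) lincomb_cat lincomb_scale lincomb_ibp IH mulr0 addr0.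
Qed.

Definition CTmaster0 : seq Z := [:: 1; 0; 0; 4]%coqZ.
Definition CTmaster1 : seq Z := [:: 32; 32; 0; 240]%coqZ.

Definition zsum (p : seq Z) : Z := foldr Z.add Z0 p.

Lemma peval1 p : peval 1 p = ratZ (zsum p).
Proof. by elim: p => //= c p IH; rewrite ratZD IH mul1r. Qed.

Lemma CTmaster0E b : (b < 4)%N -> CTmaster 0 b = ratZ (nth Z0 CTmaster0 b).
Proof. by case: b => [|[|[|[|]]]] // _; vm_compute. Qed.

Lemma CTmaster1E b : (b < 4)%N -> CTmaster 1 b = ratZ (nth Z0 CTmaster1 b).
Proof. by case: b => [|[|[|[|]]]] // _; vm_compute. Qed.

Lemma CTmaster_rec n a : (a < 4)%N ->
  peval n.+1%:R (rowD a) * CTmaster n a =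
  \sum_(0 <= b < 4) peval n.+1%:R (entryN a b) * CTmaster n.+1 b.
Proof.
(* At x = 1 the base power 2x - 3 is negative, so this row is checked on the explicit vectors v(0)
   and v(1). *)
move=> a4; case: n => [|n].
  rewrite !big_nat_recl // big_geq // CTmaster0E // !CTmaster1E // !peval1.
  rewrite addr0 -!ratZM -!ratZD; congr ratZ.
  by case: a a4 => [|[|[|[|]]]] // _; vm_compute.
have aI : a \in iota 0 4 by rewrite mem_iota.
have := vanishesP n.+2%:R (2 * n).+1 (allP row_check a aI).
rewrite lincomb_cat lincomb_scale lincomb_row_ibps mulr0 addr0 /row_terms.
rewrite lincomb_cons /lincomb big_map.
cbn [fst snd]; rewrite addn1 addn3 /CTmaster !mulnS => /eqP.
rewrite addr_eq0 => /eqP ->; rewrite -sumrN; apply: eq_bigr => b _.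
have eN1 : ratZ (-1)%coqZ = -1 by [].
by rewrite peval_scale eN1 mulN1r mulNr opprK.
Qed.

Lemma ratZ_gt0 z : Z.ltb 0 z -> 0 < ratZ z.
Proof.
by case: z => // p _; rewrite /ratZ /= ltr0n; apply/ssrnat.ltP/Pos2Nat.is_pos.
Qed.

(** If k > 0 and c + k > 0, then c + k x > 0 for all x >= 1. Hence D(x) can be cancelled at positive
    integers. *)
Lemma pprod_gt0 n s :
  all (fun f => if f is [:: c; k] then Z.ltb 0 k && Z.ltb 0 (Z.add c k)
                else false) s ->
  0 < peval n.+1%:R (pprod s).
Proof.
have r1 : ratZ 1%coqZ = 1 by [].
elim: s => [|f s IH]; first by rewrite /= r1 mulr0 addr0.
case: f => [|c [|k [|]]] // /andP[/andP[/ratZ_gt0 k0 /ratZ_gt0]].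
rewrite ratZD => ck0 /IH s0.
have -> : pprod ([:: c; k] :: s) = pmulz [:: c; k] (pprod s) by [].
rewrite peval_mul.
rewrite mulr_gt0 //= mulr0 addr0 -natr1.
have := mulr_ge0 (ler0n _ n) (ltW k0); lra.
Qed.

Definition dotmaster (n : nat) (Q : seq (seq Z)) : rat :=
  \sum_(0 <= b < 4) peval n%:R (nth [::] Q b) * CTmaster n b.

(* The quotient of p by f = [:: c; k] when it is exact. *)
Definition pdiv_lin (p f : seq Z) : seq Z :=
  behead (foldr (fun a q =>
    Z.div (Z.sub a (Z.mul (nth Z0 f 0) (head Z0 q))) (nth Z0 f 1) :: q) [::] p).

(** Entry b of Q(x-1) D(x)^-1 N(x), multiplied by [commonD]; the cofactors [rowC] clear the row
    denominators. *)
Definition transport (Q : seq (seq Z)) (b : nat) : seq Z :=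
  foldr padd [::]
    [seq pmulz (pmulz (pshift (nth [::] Q a)) (rowC a)) (entryN a b)
       | a <- iota 0 4].

Definition chain_next (P : seq Z) (Q : seq (seq Z)) (b : nat) : seq Z :=
  let p := padd (if b == 0%N then pmulz commonD P else [::]) (transport Q b) in
  foldl pdiv_lin [seq Z.div c commonK | c <- p] factors.

(* The division in [chain_next] need not be trusted: its result R is multiplied
   back.  The last condition handles n = j, where the sum on the left of the
   telescoping identity has the single term P_j(0) r(0). *)
Definition chain_ok (P : seq Z) (Q R : seq (seq Z)) : bool :=
  all (fun b => pzero (padd (pmulz commonD (nth [::] R b))
      (pscale (-1)%coqZ (padd (if b == 0%N then pmulz commonD P else [::])
                           (transport Q b))))) (iota 0 4) &&
  (head Z0 P ==
   foldr Z.add Z0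
     [seq Z.mul (head Z0 (nth [::] R b)) (nth Z0 CTmaster0 b) | b <- iota 0 4]).

Definition chain_step (P : seq Z) (st : seq (seq Z) * bool) : seq (seq Z) * bool :=
  let R := [seq chain_next P st.1 b | b <- iota 0 4] in
  (R, st.2 && chain_ok P st.1 R).

(** Computes the Q_j from the last row downwards, starting from 0; the flag records that every check
    succeeded. *)
Definition chain : seq (seq Z) -> seq (seq Z) * bool :=
  foldr chain_step ([::], true).

Lemma chain_check : all pzero (chain annihilator).1 && (chain annihilator).2.
Proof. by vm_compute. Qed.

(** For [ps] = P_0, P_1, ..., the coefficient of z^n in sum_i z^i P_i(theta) applied to the
    generating series of r. *)
Fixpoint opsum (ps : seq (seq Z)) (n : nat) : rat :=
  if ps is P :: qs then
    peval n%:R P * CTmaster n 0 + (if n is m.+1 then opsum qs m else 0)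
  else 0.

Lemma rowCD n a : (a < 4)%N ->
  peval n (rowC a) * peval n (rowD a) = peval n commonD.
Proof.
move=> a4; apply/eqP; rewrite -peval_mul -subr_eq0 -mulN1r.
have <- : ratZ (-1)%coqZ = -1 by [].
rewrite -peval_scale -peval_add; apply/eqP/peval_zero.
by case: a a4 => [|[|[|[|]]]] // _; vm_compute.
Qed.

Lemma commonD_neq0 n : peval n.+1%:R commonD != 0.
Proof.
have K0 : 0 < ratZ commonK := @ratZ_gt0 commonK isT.
have f0 := @pprod_gt0 n factors isT.
rewrite /commonD peval_scale; apply: lt0r_neq0; exact: mulr_gt0 K0 f0.
Qed.

Lemma peval0 p : peval 0 p = ratZ (head Z0 p).
Proof. by case: p => //= c p; rewrite mul0r addr0. Qed.

Lemma peval_transport x Q b :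
  peval (x + 1) (transport Q b) =
  \sum_(0 <= a < 4) peval x (nth [::] Q a) * peval (x + 1) (rowC a)
                    * peval (x + 1) (entryN a b).
Proof.
rewrite /transport /index_iota; elim: (iota 0 _) => [|a s IH].
  by rewrite big_nil.
by rewrite big_cons /= peval_add IH !peval_mul peval_shift.
Qed.

(** Induction on the list: the tail at n - 1 equals Q(n-1) . v(n-1), which the first-order system
    rewrites in terms of v(n). The comparison is made after multiplication by D(n), nonzero for n >=
    1. *)
Lemma chain_sum ps n : (chain ps).2 -> opsum ps n = dotmaster n (chain ps).1.
Proof.
elim: ps n => [|P qs IH] n.
  by rewrite /dotmaster big1 // => b _; rewrite nth_nil mul0r.
have -> : chain (P :: qs) = chain_step P (chain qs) by [].
rewrite /chain_step; case: (chain qs) IH => Q ok IH; cbn [fst snd] in *.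
move: [seq chain_next _ _ _ | _ <- _] => R /andP[/IH{}IH].
have -> : opsum (P :: qs) n = peval n%:R P * CTmaster n 0 +
                              (if n is m.+1 then opsum qs m else 0) by [].
move=> /andP[/allP div /eqP init]; case: n => [|n].
  rewrite addr0 /dotmaster peval0 init CTmaster0E //.
  rewrite !big_nat_recl // big_geq // !CTmaster0E // !peval0 addr0.
  by rewrite -!ratZM -!ratZD Z.mul_1_r /= Z.add_0_r.
apply: (mulfI (commonD_neq0 n)).
have {}div b : (b < 4)%N -> peval n.+1%:R commonD * peval n.+1%:R (nth [::] R b) =
    (if b == 0%N then peval n.+1%:R commonD * peval n.+1%:R P else 0) +
    peval n.+1%:R (transport Q b).
  move=> b4; have /div/(peval_zero n.+1%:R) : b \in iota 0 4 by rewrite mem_iota.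
  have eN1 : ratZ (-1)%coqZ = -1 by [].
  rewrite peval_add peval_scale eN1 mulN1r peval_add peval_mul => /eqP.
  by rewrite subr_eq0 => /eqP ->; case: ifP; rewrite ?peval_mul.
rewrite mulrDr IH /dotmaster !mulr_sumr.
rewrite [RHS]big_nat_cond.
under [RHS]eq_bigr => b.
  rewrite andbT => /andP[_ b4]; rewrite mulrA div // mulrDl -natr1 peval_transport.
  rewrite mulr_suml natr1; over.
rewrite -big_nat_cond big_split; congr (_ + _).
  move: (peval _ commonD) => D.
  rewrite big_nat_recl //= big1 ?addr0 ?mulrA // => b _.
  by rewrite mul0r.
(* Summing over b first isolates row a of the system; splitting D as [rowC a] times [rowD a] then
   allows [CTmaster_rec]. *)
rewrite [RHS]exchange_big; apply: eq_big_nat => a /andP[_ a4].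
transitivity (peval n%:R (nth [::] Q a) * peval n.+1%:R (rowC a) *
    \sum_(0 <= b < 4) peval n.+1%:R (entryN a b) * CTmaster n.+1 b).
  by rewrite -CTmaster_rec // -(rowCD _ a4); ring.
by rewrite mulr_sumr; apply: eq_bigr => b _; rewrite mulrA.
Qed.

Lemma opsum_annihilator n : opsum annihilator n = 0.
Proof.
move: chain_check => /andP[/allP Q0 ok]; rewrite (chain_sum n ok) {ok} /dotmaster.
move: (chain annihilator).1 Q0 => Q Q0; apply: big1 => b _.
have [bQ|Qb] := ltnP b (size Q); last by rewrite nth_default // mul0r.
by rewrite peval_zero ?mul0r // Q0 ?mem_nth.
Qed.

(** * The differential equation and the recurrence *)

Lemma ratZ_neq0 z : z != Z0 -> ratZ z != 0.
Proof.
by move=> z0; rewrite intr_eq0 -(rmorph0 int_of_Z) (inj_eq (can_inj int_of_ZK)).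
Qed.

Lemma pevalE m x p : (size p <= m)%N ->
  peval x p = \sum_(k < m) ratZ (nth Z0 p k) * x ^+ k.
Proof.
elim: p m => [|c p IH] m.
  by move=> _; rewrite big1 // => k _; rewrite nth_nil mul0r.
case: m => // m sp; rewrite big_ord_recl expr0 mulr1 /= (IH m) // mulr_sumr.
by congr (_ + _); apply: eq_bigr => k _; rewrite /bump add1n exprS mulrCA.
Qed.

Lemma opsumE ps n :
  opsum ps n = \sum_(i < n.+1) peval (n - i)%:R (nth [::] ps i) * CTmaster (n - i) 0.
Proof.
elim: ps n => [|P qs IH] n.
  by rewrite big1 // => i _; rewrite nth_nil mul0r.
rewrite big_ord_recl subn0.
have -> : opsum (P :: qs) n = peval n%:R P * CTmaster n 0 +
                              (if n is m.+1 then opsum qs m else 0) by [].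
by congr (_ + _); case: n => [|n]; rewrite ?big_ord0 // IH.
Qed.

Lemma iter_thetaE k (f : fps) n : iter k theta f n = n%:R ^+ k * f n.
Proof. by elim: k => [|k IH] /=; rewrite ?mul1r // /theta IH exprS mulrA. Qed.

Lemma CTmaster_r34 n : CTmaster n 0 = (r34 n)%:R.
Proof. by rewrite r34_CT. Qed.

Definition annihilator_coef (i k : nat) : rat :=
  ratZ (nth Z0 (nth [::] annihilator i) k).

Lemma size_annihilator i : (size (nth [::] annihilator i) <= 9)%N.
Proof.
have := allP (_ : all (fun p => size p <= 9)%N annihilator) (nth [::] annihilator i).
have [i17|?] := ltnP i (size annihilator); last by rewrite nth_default.
by apply => //; exact: mem_nth.
Qed.

Theorem theorem2 :
  (exists u : 'I_9 -> {poly rat},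
      (forall k, (size (u k) <= 17)%N) /\
      u ord_max != 0 /\
      (exists k, size (u k) = 17%N) /\
      (forall n : nat, apply_op u R34 n = 0)) /\
  has_poly_recurrence (fun n => (r34 n)%:R) 16.
Proof.
split.
  (* Transposing the coefficient table regroups sum_i z^i P_i(theta) as sum_k u_k(z) theta^k. *)
  pose u (k : 'I_9) := \poly_(i < 17) annihilator_coef i k.
  have uE (k : 'I_9) i : (u k)`_i = annihilator_coef i k.
    rewrite coef_poly; case: ltnP => // i17.
    by rewrite /annihilator_coef [nth [::] annihilator i]nth_default // nth_nil.
  (* This one entry shows both that u_8 is nonzero and that its degree is exactly 16. *)
  have u8 : annihilator_coef 16 (@ord_max 8) != 0 by apply: ratZ_neq0.
  exists u; split; first by move=> k; exact: size_poly.
  split.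
    by apply: contraTneq u8 => u0; rewrite -uE u0 coef0 eqxx.
  split; first by exists ord_max; exact: size_poly_eq.
  move=> n.
  rewrite -[RHS](opsum_annihilator n) opsumE /apply_op /pmul exchange_big /=.
  apply: eq_bigr => i _; rewrite (pevalE _ (size_annihilator i)) mulr_suml.
  apply: eq_bigr => k _.
  by rewrite iter_thetaE uE CTmaster_r34 mulrA.
(* In the coefficient of z^(n+16), r(n+j) has the factor P_(16-j)(n+j), so h_j(X) = P_(16-j)(X +
   j). *)
pose h (j : nat) := (\poly_(k < 9) annihilator_coef (16 - j) k) \Po ('X + j%:R%:P).
have hE j x : (h j).[x] = peval (x + j%:R) (nth [::] annihilator (16 - j)).
  by rewrite horner_comp !hornerE horner_poly (pevalE _ (size_annihilator _)).
have h_neq0 j x : peval (x + j%:R) (nth [::] annihilator (16 - j)) != 0 -> h j != 0.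
  by rewrite -hE; apply: contraNneq => ->; rewrite horner0.
exists (fun j => h j); split.
  by apply: (h_neq0 _ 0); rewrite addr0 peval0; apply: ratZ_neq0.
split.
  (* P_0 vanishes at 0, so h_16 is tested at 1 - 16, where its value P_0(1) is a nonzero sum of
     coefficients. *)
  apply: (h_neq0 _ (1 - 16%:R)); rewrite subrK peval1; exact: ratZ_neq0.
move=> n; rewrite -[RHS](opsum_annihilator (n + 16)) opsumE -addnS.
rewrite -(big_mkord xpredT (fun i => peval (n + 16 - i)%:R (nth [::] annihilator i) *
                                     CTmaster (n + 16 - i) 0)).
(* Only the 17 rows i <= 16 contribute; the rest read the default empty polynomial. Reversal by j =
   16 - i follows. *)
rewrite (@big_cat_nat _ _ _ 17) ?leq_addl //= [X in _ + X]big_nat_cond.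
rewrite [X in _ + X]big1 ?addr0 => [|i /andP[/andP[i17 _] _]]; last first.
  by rewrite [nth [::] annihilator i]nth_default // mul0r.
rewrite big_mkord (reindex_inj rev_ord_inj) /=; apply: eq_bigr => j _.
have j16 : (j <= 16)%N by rewrite -ltnS.
rewrite hE subSS -addnBA ?leq_subr // subKn // natrD.
by rewrite CTmaster_r34.
Qed.
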